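(* Let $K$ be a field, $k\ge 1$ an integer, $I\subset S=K[x_1,\ldots,x_n]$ a (proper) $k$-Borel ideal, and let $\mathbf a\in\mathbb Z^n$ be a $k$-bounded vector. Let $1\le j\le n$ and let $H_i(j)=H_i(x_n,x_{n-1},\ldots,x_j;S/I)$. Then for $i>1$ the multigraded component $H_i(j)_{\mathbf a}$ has a $K$-basis consisting of the homology classes of the cycles $$u'\,e_F\wedge e_{m(u)},\qquad u\in G(I),$$ with $F\subseteq [n]$, $|F|=i-1$, $j\le \min(F)$, $\max(F)<m(u)$ and $\operatorname{Deg}(\mathbf x^F u)=\mathbf a$. Moreover, $H_1(j)_{\mathbf a}$ has a $K$-basis consisting of the homology classes of the cycles $u'\,e_{m(u)}$ with $u\in G(I)$, $j\le m(u)$ and $\operatorname{Deg}(u)=\mathbf a$.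
   Context: Notation: $[n]=\{1,\ldots,n\}$. For a monomial ideal $I$, $G(I)$ is its unique minimal set of monomial generators; $\operatorname{supp}(u)=\{i: x_i\mid u\}$. A monomial $u=x_1^{a_1}\cdots x_n^{a_n}$ is $k$-bounded if $a_i\le k$ for all $i$; a monomial ideal is $k$-bounded if it is generated by $k$-bounded monomials. A $k$-bounded monomial ideal $I$ is $k$-Borel if for every $k$-bounded monomial $u\in I$, every $j\in\operatorname{supp}(u)$ and every $i<j$ one has $x_i(u/x_j)\in I$, provided $x_i(u/x_j)$ is $k$-bounded. A vector $\mathbf a=(a_1,\ldots,a_n)\in\mathbb Z^n$ is $k$-bounded if $0\le a_i\le k$ for all $i$. $\operatorname{Deg}(u)\in\mathbb Z^n$ is the exponent vector of $u$. For a monomial $u\neq 1$, $m(u)=\max(\operatorname{supp}(u))$ and $u'=u/x_{m(u)}$. For $F\subseteq[n]$, $\mathbf x^F=\prod_{i\in F}x_i$, and for nonempty $F$, $\min(F)$ and $\max(F)$ are its least and greatest elements. Koszul complex: $K_\bullet(x_n,\ldots,x_j;S/I)$ is the exterior algebra complex over $S/I$ on $e_j,\ldots,e_n$ with $\partial(e_l)=x_l$; for $F=\{l_1<\cdots<l_r\}$, $e_F=e_{l_1}\wedge\cdots\wedge e_{l_r}$, and for $f\in S$, $fe_F$ means $(f+I)e_F$. The complex is $\mathbb Z^n$-graded with $e_l$ of degree the $l$th unit vector, so $ue_F$ has multidegree $\operatorname{Deg}(\mathbf x^Fu)$; $H_i(j)_{\mathbf a}$ is the degree $\mathbf a$ component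 of its $i$th homology. *)

(* Defs.v *)
From HB Require Import structures.
From mathcomp Require Import all_boot all_order all_algebra.
From mathcomp Require Import generic_quotient ring_quotient.
From mathcomp Require Import boolp.
From mathcomp Require Import mpoly.

Set Implicit Arguments.
Unset Strict Implicit.
Unset Printing Implicit Defensive.

Import GRing.Theory.

Local Open Scope ring_scope.
Local Open Scope quotient_scope.

(* Variables are numbered from 0: the index l : 'I_n stands for l+1. *)

Section LmodQuotient.
Variables (K : nzRingType) (V : lmodType K) (B : submodClosed V).

Definition submod_zmod : {pred V} := B.

Lemma submod_zmod_closed : zmod_closed submod_zmod.
Proof.
split=> [|v w vB wB]; first exact: (rpred0 B).
by rewrite -scaleN1r; apply: (rpredD (S := B)) => //; apply: (rpredZ (s := B)).
Qed.

HB.instance Definition _ := GRing.isZmodClosed.Build V submod_zmod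
  submod_zmod_closed.

Definition lquot := Quotient.quot submod_zmod.

HB.instance Definition _ := GRing.Zmodule.on lquot.

Definition lpi (v : V) : lquot := \pi_(Quotient.quot submod_zmod) v.

Lemma lpi_eq (v w : V) : (lpi v = lpi w) <-> (v - w \in B).
Proof.
rewrite -[v - w \in B]/(v - w \in submod_zmod) Quotient.idealrBE.
by split=> /eqP.
Qed.

Lemma lpi_surj (x : lquot) : exists v, x = lpi v.
Proof. by exists (repr (x : Quotient.quot submod_zmod)); rewrite /lpi reprK. Qed.

Lemma lpiD (v w : V) : lpi (v + w) = lpi v + lpi w.
Proof. by rewrite /lpi Quotient.pi_add. Qed.

Definition lquot_scale (a : K) (x : lquot) : lquot :=
  lpi (a *: repr (x : Quotient.quot submod_zmod)).

Lemma lquot_scale_pi a v : lquot_scale a (lpi v) = lpi (a *: v).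
Proof.
apply/lpi_eq; rewrite -scalerBr; apply: (rpredZ (s := B)).
by apply/lpi_eq; rewrite /lpi reprK.
Qed.

Lemma lquot_scaleA a b x :
  lquot_scale a (lquot_scale b x) = lquot_scale (a * b) x.
Proof. by case: (lpi_surj x) => v ->; rewrite !lquot_scale_pi scalerA. Qed.

Lemma lquot_scale1 : left_id 1 lquot_scale.
Proof. by move=> x; case: (lpi_surj x) => v ->; rewrite lquot_scale_pi scale1r. Qed.

Lemma lquot_scaleDr : right_distributive lquot_scale +%R.
Proof.
move=> a x y; case: (lpi_surj x) => v ->; case: (lpi_surj y) => w ->.
by rewrite -lpiD !lquot_scale_pi scalerDr lpiD.
Qed.

Lemma lquot_scaleDl x : {morph lquot_scale^~ x : a b / a + b}.
Proof.
move=> a b; case: (lpi_surj x) => v ->.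
by rewrite !lquot_scale_pi scalerDl lpiD.
Qed.

HB.instance Definition _ := GRing.Zmodule_isLmodule.Build K lquot
  lquot_scaleA lquot_scale1 lquot_scaleDr lquot_scaleDl.

End LmodQuotient.

(* [w], indexed by the [t] such that [P t], is a basis of the subspace [H].   *)
Definition is_basis_of (K : fieldType) (W : lmodType K) (H : W -> Prop)
    (T : eqType) (P : T -> Prop) (w : T -> W) : Prop :=
  [/\ forall t, P t -> H (w t),
      forall (s : seq T) (c : T -> K), uniq s -> (forall t, t \in s -> P t) ->
        \sum_(t <- s) c t *: w t = 0 -> forall t, t \in s -> c t = 0 &
      forall h, H h -> exists (s : seq T) (c : T -> K),
        (forall t, t \in s -> P t) /\ h = \sum_(t <- s) c t *: w t].

Section Monomials.
Variables (n : nat).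
Implicit Types (u : 'X_{1..n}) (F : {set 'I_n}).

(* x^F *)
Definition xF F : 'X_{1..n} := [multinom (l \in F : nat) | l < n].

Definition supp u : {set 'I_n} := [set l | u l != 0%N].

Definition Deg u : 'rV[int]_n := \row_l (u l)%:Z.

Definition bounded_monom (k : nat) u : Prop := forall l, (u l <= k)%N.

Definition bounded_vec (k : nat) (a : 'rV[int]_n) : Prop :=
  forall l, 0 <= a 0 l <= k%:Z.

End Monomials.

(* [set_min], [set_max] and [mvar] are meaningful only for a nonempty set and *)
(* a monomial other than 1; elsewhere they take the default value ord0.       *)
Section MinMax.
Variables (n : nat).
Implicit Types (u : 'X_{1..n.+1}) (F : {set 'I_n.+1}).

Definition set_min F : 'I_n.+1 := [arg min_(l < ord0 in F) (l : nat)]%N.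
Definition set_max F : 'I_n.+1 := [arg max_(l > ord0 in F) (l : nat)]%N.

(* m(u) *)
Definition mvar u : 'I_n.+1 := set_max (supp u).

(* u / x_m(u) *)
Definition mprime u : 'X_{1..n.+1} := (u - U_(mvar u))%MM.

End MinMax.

Section MonomialIdeals.
Variables (n : nat) (K : fieldType).
Local Notation S := {mpoly K[n]}.
Implicit Types (I : idealr S) (A : 'X_{1..n} -> Prop).

Definition generated_by I A : Prop :=
  forall f : S, (f \in I) <->
    exists s : seq (S * 'X_{1..n}),
      (forall p, p \in s -> A p.2) /\ f = \sum_(p <- s) p.1 * 'X_[p.2].

Definition minimal_generators I A : Prop :=
  generated_by I A /\
  forall A', (forall u, A' u -> A u) -> generated_by I A' ->
    forall u, A u -> A' u.

Definition mem_G I (u : 'X_{1..n}) : Prop :=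
  exists2 A, minimal_generators I A & A u.

Definition bounded_ideal (k : nat) I : Prop :=
  exists2 A, (forall u, A u -> bounded_monom k u) & generated_by I A.

Definition k_borel (k : nat) I : Prop :=
  bounded_ideal k I /\
  forall u : 'X_{1..n}, bounded_monom k u -> 'X_[u] \in I ->
  forall j i : 'I_n, j \in supp u -> (i < j)%N ->
    bounded_monom k (U_(i) + (u - U_(j)))%MM ->
    'X_[U_(i) + (u - U_(j))] \in I.

End MonomialIdeals.

Section Koszul.
Variables (n : nat) (K : fieldType).
Local Notation S := {mpoly K[n]}.
Variable I : idealr S.

Definition SmodI := {ideal_quot I}.

HB.instance Definition _ := GRing.ComNzRing.on SmodI.

Definition cls (f : S) : SmodI := \pi_{ideal_quot I} f.

Lemma clsD f g : cls (f + g) = cls f + cls g.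
Proof. exact: rmorphD. Qed.
Lemma clsM f g : cls (f * g) = cls f * cls g.
Proof. exact: rmorphM. Qed.
Lemma cls1 : cls 1 = 1.
Proof. exact: rmorph1. Qed.

Definition SmodI_scale (c : K) (r : SmodI) : SmodI := cls c%:MP * r.

Lemma SmodI_scaleA a b r :
  SmodI_scale a (SmodI_scale b r) = SmodI_scale (a * b) r.
Proof. by rewrite /SmodI_scale mpolyCM clsM mulrA. Qed.
Lemma SmodI_scale1 : left_id 1 SmodI_scale.
Proof. by move=> r; rewrite /SmodI_scale cls1 mul1r. Qed.
Lemma SmodI_scaleDr : right_distributive SmodI_scale +%R.
Proof. by move=> a r s; rewrite /SmodI_scale mulrDr. Qed.
Lemma SmodI_scaleDl r : {morph SmodI_scale^~ r : a b / a + b}.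
Proof. by move=> a b; rewrite /SmodI_scale mpolyCD clsD mulrDl. Qed.

HB.instance Definition _ := GRing.Zmodule_isLmodule.Build K SmodI
  SmodI_scaleA SmodI_scale1 SmodI_scaleDr SmodI_scaleDl.

(* The exterior algebra over S/I on e_1, ..., e_n: [c F] is the coefficient   *)
(* of [c] on e_F.                                                             *)
Definition ext := {ffun {set 'I_n} -> SmodI}.

HB.instance Definition _ := GRing.Lmodule.on ext.

Definition term (r : SmodI) (F : {set 'I_n}) : ext :=
  [ffun G => if G == F then r else 0].

(* e_F /\ e_G is 0 if F and G meet, and otherwise (-1)^N e_(F :|: G), with N  *)
(* the number of inversions (p, q) in F x G, p > q.                           *)
Definition wedge (c d : ext) : ext :=
  \sum_(F : {set 'I_n}) \sum_(G : {set 'I_n} | [disjoint F & G])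
    term ((-1) ^+ #|[set pq in setX F G | (pq.2 < pq.1)%N]| * (c F * d G))
         (F :|: G).

(* d(e_F) = sum over l in F of (-1)^(position of l in F, from 0) x_l e_(F-l). *)
Definition diff (c : ext) : ext :=
  \sum_(F : {set 'I_n}) \sum_(l in F)
    term ((-1) ^+ #|[set p in F | (p < l)%N]| * (cls 'X_l * c F)) (F :\ l).

(* K_i(x_n, ..., x_j; S/I). *)
Definition koszul (i : nat) (j : 'I_n) : {pred ext} :=
  [pred c : ext | `[< forall F : {set 'I_n}, c F != 0 ->
     #|F| = i /\ forall l, l \in F -> (j <= l)%N >]].

Definition boundaries (i : nat) (j : 'I_n) : {pred ext} :=
  [pred c : ext | `[< exists2 d, d \in koszul i.+1 j & c = diff d >]].

Lemma koszul_submod_closed i j : submod_closed (koszul i j).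
Proof.
split=> [|a c d /asboolP cK /asboolP dK]; apply/asboolP => F.
  by rewrite ffunE eqxx.
move=> nz; have [c0|cn0] := eqVneq (c F) 0; last exact: cK.
have [d0|dn0] := eqVneq (d F) 0; last exact: dK.
by move: nz; rewrite !ffunE c0 d0 scaler0 addr0 eqxx.
Qed.

Lemma SmodI_scalerAr (a : K) (r s : SmodI) : a *: (r * s) = r * (a *: s).
Proof. by rewrite /GRing.scale /= /SmodI_scale mulrCA. Qed.

Lemma term_is_linear F : linear (fun r => term r F).
Proof.
move=> a r s; apply/ffunP => G; rewrite !ffunE.
by case: eqP => // _; rewrite scaler0 addr0.
Qed.

Lemma diff_is_linear : linear diff.
Proof.
move=> a c d; rewrite /diff scaler_sumr -big_split /=.
apply: eq_bigr => F _; rewrite scaler_sumr -big_split /=.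
apply: eq_bigr => l _; rewrite -term_is_linear !ffunE.
by rewrite !SmodI_scalerAr !mulrDr.
Qed.

Lemma boundaries_submod_closed i j : submod_closed (boundaries i j).
Proof.
have [K0 KD] := koszul_submod_closed i.+1 j.
split=> [|a c d /asboolP[c' c'K ->] /asboolP[d' d'K ->]]; apply/asboolP.
  exists 0 => //; have := diff_is_linear (-1) 0 0.
  by rewrite scaleN1r oppr0 addr0 scaleN1r addNr.
by exists (a *: c' + d'); [exact: KD | rewrite diff_is_linear].
Qed.

HB.instance Definition _ i j :=
  GRing.isSubmodClosed.Build K ext (boundaries i j)
    (boundaries_submod_closed i j).

(* The component of degree b of the Z^n-graded ring S/I. *)
Definition SmodI_deg (b : 'rV[int]_n) (r : SmodI) : Prop :=
  exists2 f : S, (forall u, u \in msupp f -> Deg u = b) & r = cls f.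

Definition ext_deg (a : 'rV[int]_n) (c : ext) : Prop :=
  forall F, SmodI_deg (a - Deg (xF F)) (c F).

(* The chain f e_F, for a polynomial f. *)
Definition chain (f : S) (F : {set 'I_n}) : ext := term (cls f) F.

Definition is_cycle (i : nat) (j : 'I_n) (c : ext) : Prop :=
  c \in koszul i j /\ diff c = 0.

(* H_i(j) is the subspace of [ext] modulo boundaries formed by the classes of *)
(* the cycles; its component of degree a is formed by the classes of the      *)
(* cycles which are homogeneous of degree a.                                  *)
Definition ext_mod_boundaries (i : nat) (j : 'I_n) := lquot (boundaries i j).

HB.instance Definition _ i j := GRing.Lmodule.on (ext_mod_boundaries i j).

Definition hclass (i : nat) (j : 'I_n) (c : ext) : ext_mod_boundaries i j :=
  lpi (boundaries i j) c.

Definition homology (i : nat) (j : 'I_n) (a : 'rV[int]_n)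
    (h : ext_mod_boundaries i j) : Prop :=
  exists c, [/\ is_cycle i j c, ext_deg a c & h = hclass i j c].

End Koszul.

(* Main.v *)
Require Import Defs.
From mathcomp Require Import all_boot all_order all_algebra.
From mathcomp Require Import ring_quotient mpoly.
From mathcomp Require Import boolp generic_quotient.

(** Fix a [k]-bounded degree and let [b] be the monomial with that exponent
    vector. In degree [b] a chain has, on each [e_F], a scalar multiple of
    [x^b / x^F], so the Koszul complex in this degree is a simplicial chain
    complex over [K]: a chain is a function on the sets [F] of indices at least
    [j] contained in [supp b], two chains being equal when they agree on the
    sets [F] that are live, meaning that [x^b / x^F] is not in [I], and the
    differential is the simplicial boundary [bd].

    Let [m] be the largest variable of [b]. Coning with apex [m] is a homotopy
    which shows that every chain of positive homological degree is, up to a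
    boundary, supported on sets containing [m] ([swept_supp]). Suppose that such a chain has a boundary
    which vanishes on the live sets avoiding [m]. Then it only involves the
    critical sets ([apex_critical]): the live [G] containing [m] such that
    [G - m] is not live. The [k]-Borel property moves the statement that
    [x^b / x^(G - m)] is in [I] to [x^b / x^(G - l)] for every [l] in [G]
    ([borel_critical_facet]), so that each critical [e_G] is a cycle, and in
    fact the chain considered is itself a cycle ([apex_cycle]). Applied to a
    cycle, this shows that the classes of the critical [e_G] span the homology.
    Applied to a chain [d] whose boundary is a combination of critical [e_G],
    it shows that this combination is zero, hence independence. Together this is
    [homology_basis].

    It remains to identify the critical sets. For the same [m], the map
    [G |-> (x^b / x^(G - m), G - m)] is a bijection from the critical sets onto
    the pairs [(u, F)] with [u] in [G(I)], [max F < m(u)] and [x^F u = x^b]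
    ([critical_generator], [generator_critical]); in particular [m(u) = m], and
    the chain [u' e_F /\ e_m(u)] is exactly [x^b / x^G] times [e_G]. *)

Set Implicit Arguments.
Unset Strict Implicit.
Unset Printing Implicit Defensive.

Import GRing.Theory.

Local Open Scope ring_scope.

(** * Monomial ideals and their minimal generators *)

Section MonomialIdealLemmas.
Variables (n : nat) (K : fieldType).
Local Notation S := {mpoly K[n]}.
Implicit Types (I : idealr S) (A : 'X_{1..n} -> Prop) (u v : 'X_{1..n}).

(** Membership in a monomial ideal is decided monomial by monomial, so the
    generating sets of [I] can be compared by divisibility alone. *)
Lemma generated_byP I A :
  generated_by I A <->
  forall f : S, f \in I <->
    forall v, v \in msupp f -> exists2 u, A u & (u <= v)%MM.
Proof.
split=> genI f; last first.
  split=> [fI|[s [sA ->]]]; last first.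
    rewrite big_seq; apply: rpred_sum => p /sA Ap; apply: idealMr.
    by apply/genI => v; rewrite msuppX inE => /eqP ->; exists p.2; rewrite ?lepm_refl.
  have /choice [g gP] v : exists u, v \in msupp f -> A u /\ (u <= v)%MM.
    have [vf|_] := boolP (v \in msupp f); last by exists v.
    by have [u Au uv] := (genI f).1 fI v vf; exists u.
  exists [seq (f@_v *: 'X_[v - g v], g v) | v <- msupp f]; split.
    by move=> p /mapP[v vf ->]; case: (gP v vf).
  rewrite big_map [LHS]mpolyE; apply: eq_big_seq => v /gP[_ gv] /=.
  by rewrite -scalerAl -mpolyXD submK.
split=> [/genI[s [sA ->]]|Hf].
  elim: s sA => [|p s IHs] sA v; first by rewrite big_nil msupp0.
  rewrite big_cons => /msuppD_le; rewrite mem_cat => /orP[|].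
    rewrite (perm_mem (msuppMX _ _)) => /mapP[w _ ->]; exists p.2.
      by apply: sA; rewrite inE eqxx.
    exact: lem_addr.
  by apply: IHs => q qs; apply: sA; rewrite inE qs orbT.
rewrite [f]mpolyE big_seq; apply: rpred_sum => v /Hf[u Au uv].
rewrite -(submK uv) mpolyXD scalerAl; apply: idealMr.
apply/genI; exists [:: (1, u)]; split=> [p|]; last by rewrite big_seq1 mul1r.
by rewrite inE => /eqP ->.
Qed.

Lemma monom_mem_ideal I A u : generated_by I A ->
  'X_[u] \in I <-> exists2 v, A v & (v <= u)%MM.
Proof.
move=> /generated_byP/(_ 'X_[u])[h1 h2]; split=> [/h1|[v Av vu]].
  by apply; rewrite msuppX inE.
by apply: h2 => w; rewrite msuppX inE => /eqP ->; exists v.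
Qed.

Lemma ideal_monomW I u v : (u <= v)%MM -> 'X_[u] \in I -> 'X_[v] \in I.
Proof. by move=> uv uI; rewrite -(submK uv) mpolyXD idealMr. Qed.

Lemma mcoeff_ideal I A f u : generated_by I A -> f \in I ->
  'X_[u] \notin I -> f@_u = 0.
Proof.
move=> genI fI uNI; apply/eqP; rewrite mcoeff_eq0; apply: contra uNI => uf.
by apply/(monom_mem_ideal _ genI); exact: ((generated_byP _ _).1 genI f).1 fI _ uf.
Qed.

(** [G(I)] consists of the monomials of [I] that leave [I] when divided by any
    one of their variables. *)
Lemma mem_GP I A u : generated_by I A ->
  mem_G I u <->
    'X_[u] \in I /\ forall l, u l != 0%N -> 'X_[u - U_(l)] \notin I.
Proof.
move=> genI.
have U_le w l : (U_(l) <= w)%MM = (w l != 0%N).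
  apply/mnm_lepP/idP => [/(_ l)|wl i]; first by rewrite mnm1E eqxx lt0n.
  by rewrite mnm1E; case: eqP => [<-|//]; rewrite lt0n.
have divE v w : (v <= w)%MM -> v != w ->
    exists2 l, w l != 0%N & (v <= w - U_(l))%MM.
  move=> /mnm_lepP vw /eqP vNw.
  have /existsP[l vl] : [exists l, v l != w l].
    apply: contra_notT vNw; rewrite negb_exists => /forallP vw'.
    by apply/mnmP => l; have /negPn/eqP := vw' l.
  have vwl : (v l < w l)%N by rewrite ltn_neqAle vl vw.
  exists l; first by rewrite -lt0n (leq_ltn_trans _ vwl).
  apply/mnm_lepP => i; rewrite mnmBE mnm1E; case: eqP => [<-|_].
    by rewrite leq_subRL ?add1n // (leq_ltn_trans _ vwl).
  by rewrite subn0.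
split=> [[B [genB minB] Bu]|[uI uN]].
  have uI : 'X_[u] \in I.
    by apply/(monom_mem_ideal _ genB); exists u => //; exact: lepm_refl.
  split=> // l ul; apply/negP => /(monom_mem_ideal _ genB)[v Bv vu].
  have vNu : v <> u.
    by move=> vE; move/mnm_lepP: vu => /(_ l);
       rewrite vE mnmBE mnm1E eqxx subn1 leqNgt prednK ?lt0n // leqnn.
  (* [u] is a proper multiple of [v], so [B] without [u] still generates [I]. *)
  have [] // : B u /\ u <> u.
  apply: (minB (fun w => B w /\ w <> u)) => // [w []//|].
  apply/generated_byP => f; split=> [fI w wf|Hf].
    have [w' Bw' w'w] := ((generated_byP _ _).1 genB f).1 fI w wf.
    have [w'u|/eqP w'u] := eqVneq w' u; last by exists w'.
    exists v => //; apply: (lepm_trans vu); apply: lepm_trans w'w.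
    by rewrite w'u lem_subr.
  apply/((generated_byP _ _).1 genB) => w wf.
  by have [w' [Bw' _] w'w] := Hf w wf; exists w'.
pose B w := 'X_[w] \in I /\ forall l, w l != 0%N -> 'X_[w - U_(l)] \notin I.
exists B => //; split=> [|B' subB' genB' w Bw]; last first.
  have /(monom_mem_ideal _ genB')[v B'v vw] := Bw.1.
  have [<-//|/(divE _ _ vw)[l wl vwl]] := eqVneq v w.
  have := Bw.2 l wl; rewrite (ideal_monomW vwl) //.
  exact: (subB' _ B'v).1.
have minB d w : (mdeg w <= d)%N -> 'X_[w] \in I -> exists2 v, B v & (v <= w)%MM.
  elim: d w => [|d IHd] w wd wI.
    have w0 : w = 0%MM by apply/eqP; rewrite -mdeg_eq0 -leqn0.
    by exists w; rewrite ?lepm_refl //; split=> // l; rewrite w0 mnm0E.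
  have [[l wl wlI]|wN] := pselect (exists2 l, w l != 0%N & 'X_[w - U_(l)] \in I).
    have [||v Bv vw] := IHd (w - U_(l))%MM; last 1 first.
    - by exists v => //; apply: lepm_trans vw (lem_subr _ _).
    - by have := mdegD (w - U_(l))%MM U_(l); rewrite submK ?U_le // mdeg1 => E;
        move: wd; rewrite E addn1 ltnS.
    - by [].
  exists w; rewrite ?lepm_refl //; split=> // l wl.
  by apply/negP => wlI; apply: wN; exists l.
apply/generated_byP => f; split=> [fI v vf|Hf].
  apply: (minB (mdeg v)) => //; apply/(monom_mem_ideal _ genI).
  exact: ((generated_byP _ _).1 genI f).1.
apply/((generated_byP _ _).1 genI) => v /Hf[u' [u'I _] u'v].
exact/(monom_mem_ideal _ genI)/(ideal_monomW u'v).
Qed.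

End MonomialIdealLemmas.

(** * The simplicial boundary and the cone *)

Section SimplicialBoundary.
Variables (n : nat) (K : pzRingType).
Implicit Types (F G : {set 'I_n}) (l m : 'I_n) (alpha beta : {set 'I_n} -> K).

(** The boundary of [alpha], seen as the chain of coefficient [alpha F] on the
    simplex [F]; the sign is given by the position of [l] in [l |: F]. *)
Definition bd alpha F : K :=
  \sum_(l | l \notin F) (-1) ^+ #|[set p in F | (p < l)%N]| * alpha (l |: F).

(** The cone over [alpha] with apex [m]: the simplices containing [m] are
    dropped and [m] is added to the others, without a sign. *)
Definition cone m alpha F : K := if m \in F then alpha (F :\ m) else 0.

Lemma card_below_setU1 F l l' : l \notin F ->
  #|[set p in l |: F | (p < l')%N]| = ((l < l')%N + #|[set p in F | (p < l')%N]|)%N.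
Proof.
move=> lF; case: ltnP => ll' /=; last first.
  apply: eq_card => p; rewrite !inE; case: eqP => [->|//] /=.
  by rewrite ltnNge ll' (negbTE lF).
have -> : [set p in l |: F | (p < l')%N] = l |: [set p in F | (p < l')%N].
  by apply/setP => p; rewrite !inE; case: eqP => [->|].
by rewrite cardsU1 inE (negbTE lF).
Qed.

Lemma bd_bd alpha F : bd (bd alpha) F = 0.
Proof.
pose c l := #|[set p in F | (p < l)%N]|.
pose T l l' : K := (-1) ^+ (c l + c l') * alpha (l' |: (l |: F)).
have TC l l' : T l l' = T l' l by rewrite /T addnC setUCA.
(* The removal of two vertices in either order gives opposite signs; splitting
   the double sum by which vertex is smaller avoids dividing by 2. *)
transitivity (\sum_(l | l \notin F)
    (\sum_(l' | (l' \notin F) && (l' < l)%N) T l l' -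
     \sum_(l' | (l' \notin F) && (l < l')%N) T l l')).
  apply: eq_bigr => l lF; rewrite big_distrr (bigID (fun l' => l' < l)%N) /=.
  congr (_ + _).
    apply: eq_big => l'; rewrite !inE negb_or.
      by rewrite -andbA; case: eqP => [->|//]; rewrite ltnn andbF.
    case/andP => _ l'l; rewrite card_below_setU1 // [(l < l')%N]ltnNge ltnW //=.
    by rewrite add0n /T exprD mulrA.
  rewrite -sumrN; apply: eq_big => l'; rewrite !inE negb_or -leqNgt.
    rewrite andbAC [in RHS]andbC; congr (_ && _).
    by rewrite ltn_neqAle eq_sym.
  case/andP => /andP[l'l _] ll'; rewrite card_below_setU1 //.
  rewrite ltn_neqAle ll' andbT -[_ != _]/(l != l' :> 'I_n) eq_sym l'l.
  by rewrite exprS !mulN1r mulNr mulrN /T exprD mulrA.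
rewrite sumrB; apply/eqP; rewrite subr_eq0; apply/eqP.
rewrite [LHS](exchange_big_dep (fun l => l \notin F)) /=; last first.
  by move=> ? ? _ /andP[].
apply: eq_bigr => l lF; apply: eq_big => [l'|l' _]; last exact: TC.
by rewrite lF.
Qed.

(** Away from the apex, the boundary of the cone over [alpha] is [alpha] up to
    sign. *)
Lemma bd_cone m alpha F : m \notin F ->
  bd (cone m alpha) F = (-1) ^+ #|[set p in F | (p < m)%N]| * alpha F.
Proof.
move=> mF; rewrite /bd (bigD1 m) //= big1 ?addr0 => [|l /andP[_ lm]].
  by rewrite /cone setU11 setU1K.
by rewrite /cone !inE eq_sym (negbTE lm) (negbTE mF) mulr0.
Qed.

Lemma bd_sub alpha beta F :
  bd (fun G => alpha G - beta G) F = bd alpha F - bd beta F.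
Proof. by rewrite /bd -sumrB; apply: eq_bigr => l _; rewrite mulrBr. Qed.

End SimplicialBoundary.

(** * The Koszul complex in one multidegree *)

Section Strand.
Variables (n : nat) (K : fieldType) (I : idealr {mpoly K[n]}).
Variable A : 'X_{1..n} -> Prop.
Hypothesis genI : generated_by I A.
Implicit Types (f : {mpoly K[n]}) (r : SmodI I) (c d : ext I).
Implicit Types (F G : {set 'I_n}) (l : 'I_n) (u v b : 'X_{1..n}).
Implicit Types (alpha beta : {set 'I_n} -> K).
Implicit Types (i : nat) (j : 'I_n).

Lemma cls0 : cls I 0 = 0.
Proof. exact: rmorph0. Qed.

Lemma cls_eq0 f : cls I f = 0 <-> f \in I.
Proof.
rewrite -cls0 -[f in f \in I]subr0 Quotient.idealrBE.
by split=> /eqP.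
Qed.

Lemma cls_surj r : exists f, r = cls I f.
Proof. by exists (repr (r : {ideal_quot I})); rewrite /cls reprK. Qed.

Lemma scale_cls (x : K) f : x *: cls I f = cls I (x *: f).
Proof. by rewrite -mul_mpolyC clsM. Qed.

Lemma scale_sign (k : nat) r : ((-1) ^+ k : K) *: r = (-1) ^+ k * r.
Proof.
rewrite {1}/GRing.scale /= /SmodI_scale rmorph_sign; congr (_ * _).
exact: rmorph_sign.
Qed.

(** The coefficient of [x^v] in a class of [S/I], read on a representative; it
    does not depend on the representative when [x^v] is not in [I]. *)
Definition coef v r : K := (repr (r : {ideal_quot I}))@_v.

Lemma coef_cls v f : 'X_[v] \notin I -> coef v (cls I f) = f@_v.
Proof.
move=> vI; apply/eqP; rewrite -subr_eq0 -mcoeffB; apply/eqP.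
apply: mcoeff_ideal genI _ vI.
by rewrite Quotient.idealrBE /cls reprK.
Qed.

Lemma coef_sum v (T : Type) (s : seq T) (P : pred T) (r : T -> SmodI I) :
  'X_[v] \notin I ->
  coef v (\sum_(t <- s | P t) r t) = \sum_(t <- s | P t) coef v (r t).
Proof.
move=> vI; elim/big_rec2: _ => [|t x y _ <-].
  by rewrite -cls0 coef_cls // mcoeff0.
case: (cls_surj (r t)) (cls_surj y) => f -> [g ->].
by rewrite -clsD !coef_cls // mcoeffD.
Qed.

Lemma coefX v l (k : nat) r : 'X_[v] \notin I ->
  coef v ((-1) ^+ k * (cls I 'X_l * r)) =
    if v l != 0%N then (-1) ^+ k * coef (v - U_(l)) r else 0.
Proof.
move=> vI; case: (cls_surj r) => f ->.
rewrite -scale_sign -clsM mulrC scale_cls.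
rewrite coef_cls // mcoeffZ; case: ifP => [vl|/negbFE/eqP vl].
  have lv : (U_(l) <= v)%MM.
    by apply/mnm_lepP => i; rewrite mnm1E; case: eqP => [<-|//]; rewrite lt0n.
  rewrite coef_cls; last first.
    by apply: contra vI; apply: ideal_monomW; apply: lem_subr.
  by rewrite -{1}(submK lv) addmC mcoeffMX.
suff -> : (f * 'X_l)@_v = 0 by rewrite mulr0.
apply/eqP; rewrite mcoeff_eq0 (perm_mem (msuppMX _ _)).
by apply/mapP => -[w _ vE]; move: vl; rewrite vE mnmDE mnm1E eqxx.
Qed.

(** The differential, read on the coefficient of [e_F]. *)
Lemma diffE c F : diff c F = \sum_(l | l \notin F)
  (-1) ^+ #|[set p in F | (p < l)%N]| * (cls I 'X_l * c (l |: F)).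
Proof.
rewrite /diff sum_ffunE.
under eq_bigr => G _ do rewrite sum_ffunE.
rewrite (exchange_big_dep xpredT) //= [RHS]big_mkcond; apply: eq_bigr => l _.
have [lF|lF] := boolP (l \in F); rewrite /=.
  apply: big1 => G lG; rewrite ffunE; case: eqP => // FE.
  by move: lF; rewrite FE !inE eqxx.
rewrite (bigD1 (l |: F)) ?setU11 //= big1 ?addr0 => [|G /andP[lG GN]].
  rewrite ffunE setU1K // eqxx; congr ((-1) ^+ _ * _).
  by apply: eq_card => p; rewrite !inE; case: eqP => // ->; rewrite ltnn !andbF.
by rewrite ffunE; case: eqP => // FE; rewrite FE setD1K ?eqxx in GN.
Qed.

Variable b : 'X_{1..n}.

(** [x^F] divides [x^b]. *)
Definition fits F := F \subset supp b.

(** The simplices [F] for which [e_F] contributes to degree [b]. *)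
Definition live F := fits F && ('X_[b - xF F] \notin I).

(** The chain of degree [b] with coefficients [alpha]. The subtraction of
    exponents is truncated, so this is meaningful only when [alpha] vanishes on
    the [F] that do not fit. *)
Definition strand alpha : ext I := [ffun F => alpha F *: cls I 'X_[b - xF F]].

(** The coefficients of the component of degree [b] of a chain, which need not
    be homogeneous; they are set to 0 on the simplices that are not live. *)
Definition coords c F : K := if live F then coef (b - xF F) (c F) else 0.

Lemma mem_supp u l : (l \in supp u) = (u l != 0%N).
Proof. by rewrite inE. Qed.

Lemma fits_le F : fits F = (xF F <= b)%MM.
Proof.
apply/subsetP/mnm_lepP => [H l|H l lF]; last first.
  by rewrite mem_supp -lt0n; have := H l; rewrite mnmE lF.
by rewrite mnmE; case: (boolP (l \in F)) => // /H; rewrite mem_supp lt0n.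
Qed.

Lemma xF_setU1 F l : l \notin F -> xF (l |: F) = (U_(l) + xF F)%MM.
Proof.
move=> lF; apply/mnmP => i; rewrite mnmDE !mnmE !inE eq_sym.
by case: eqP => [<-|//]; rewrite (negbTE lF).
Qed.

Lemma sub_xF_setU1 F l : l \notin F ->
  (b - xF (l |: F) = b - xF F - U_(l))%MM.
Proof.
move=> lF; apply/mnmP => i; rewrite xF_setU1 //.
by rewrite !mnmBE mnmDE addnC subnDA.
Qed.

Lemma fits_setU1 F l : fits (l |: F) = (b l != 0%N) && fits F.
Proof. by rewrite /fits subUset sub1set inE. Qed.

Lemma sub_xF_notin F l : l \notin F -> (b - xF F)%MM l = b l.
Proof. by move=> lF; rewrite mnmBE mnmE (negbTE lF) subn0. Qed.

Lemma mul_sub_xF F l : l \notin F -> fits (l |: F) ->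
  cls I 'X_l * cls I 'X_[b - xF (l |: F)] = cls I 'X_[b - xF F].
Proof.
move=> lF; rewrite fits_setU1 => /andP[bl _].
rewrite -clsM -mpolyXD sub_xF_setU1 // addmC submK //.
apply/mnm_lepP => i; rewrite mnm1E; case: eqP => // <-.
by rewrite sub_xF_notin // lt0n.
Qed.

Lemma live_setU1 F l : l \notin F -> live F -> fits (l |: F) -> live (l |: F).
Proof.
move=> lF /andP[_ FI] fitF; rewrite /live fitF /=; apply: contra FI.
by rewrite sub_xF_setU1 //; apply: ideal_monomW; apply: lem_subr.
Qed.

Lemma coords_strand alpha F : live F -> coords (strand alpha) F = alpha F.
Proof.
rewrite /coords => LF; rewrite LF; case/andP: LF => _ XF.
by rewrite ffunE scale_cls coef_cls // mcoeffZ mcoeffX eqxx mulr1.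
Qed.

(** Since [c] is arbitrary, this also says that the differential commutes with
    the projection onto the component of degree [b]. *)
Lemma coords_diff c F : live F -> coords (diff c) F = bd (coords c) F.
Proof.
move=> LF; rewrite {1}/coords LF diffE; case/andP: (LF) => fitF XF.
rewrite coef_sum //; apply: eq_bigr => l lF; rewrite coefX // sub_xF_notin //.
rewrite /coords -sub_xF_setU1 //.
have [bl|bl] := ifP; last by rewrite /live fits_setU1 bl /= mulr0.
by rewrite live_setU1 // fits_setU1 bl.
Qed.

Lemma coords_fits c F : coords c F != 0 -> fits F.
Proof. by rewrite /coords /live; case: (fits F); rewrite //= eqxx. Qed.

Lemma coords_koszul i j c F : c \in koszul i j -> coords c F != 0 ->
  #|F| = i /\ forall l, l \in F -> (j <= l)%N.
Proof.
move=> /asboolP cK; rewrite /coords; case: ifP; rewrite ?eqxx // => /andP[_ XF] cF.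
apply: cK; apply: contra_neq cF => ->.
by rewrite -cls0 coef_cls // mcoeff0.
Qed.

Lemma strand_koszul i j alpha :
  (forall F, alpha F != 0 -> #|F| = i /\ forall l, l \in F -> (j <= l)%N) ->
  strand alpha \in koszul i j.
Proof.
move=> H; apply/asboolP => F; rewrite ffunE => aF; apply: H.
by apply: contra_neq aF => ->; rewrite scale0r.
Qed.

Lemma eq_strand alpha beta :
    (forall F, alpha F != 0 -> fits F) -> (forall F, beta F != 0 -> fits F) ->
  (forall F, live F -> alpha F = beta F) -> strand alpha = strand beta.
Proof.
move=> fa fb H; apply/ffunP => F; rewrite !ffunE.
have [/H -> //|] := boolP (live F); rewrite /live.
have [_ /negPn XF|NF _] := boolP (fits F).
  by rewrite (cls_eq0 _).2 // !scaler0.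
have -> : alpha F = 0 by apply/eqP; apply: contraNT NF; apply: fa.
by have -> : beta F = 0 by apply/eqP; apply: contraNT NF; apply: fb.
Qed.

Lemma diff_strand alpha : (forall F, alpha F != 0 -> fits F) ->
  diff (strand alpha) = strand (bd alpha).
Proof.
move=> fa; apply/ffunP => F; rewrite diffE ffunE /bd scaler_suml.
apply: eq_bigr => l lF; rewrite ffunE.
have [->|/fa fitF] := eqVneq (alpha (l |: F)) 0.
  by rewrite scale0r !mulr0 scale0r.
by rewrite -(mul_sub_xF lF fitF) -scalerA scale_sign SmodI_scalerAr.
Qed.

Lemma Deg_inj : injective (@Deg n).
Proof. by move=> u v /rowP H; apply/mnmP => l; have := H l; rewrite !mxE => -[]. Qed.

Lemma DegD u v : Deg (u + v)%MM = Deg u + Deg v.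
Proof. by apply/rowP => l; rewrite !mxE mnmDE. Qed.

Lemma coordsK c : ext_deg (Deg b) c -> strand (coords c) = c.
Proof.
move=> dc; apply/ffunP => F; rewrite ffunE; have [f Hf cF] := dc F.
have fE u : u \in msupp f -> (xF F + u)%MM = b.
  by move=> /Hf uE; apply: Deg_inj; rewrite DegD uE addrC subrK.
have [fitF|NF] := boolP (fits F); last first.
  rewrite cF [f]mpolyE big_seq big1; last first.
    by move=> u /fE ub; move: NF; rewrite fits_le -ub lem_addr.
  by rewrite /coords /live (negbTE NF) scale0r cls0.
have -> : c F = f@_(b - xF F) *: cls I 'X_[b - xF F].
  rewrite cF scale_cls; congr (cls I _); apply/mpolyP => u.
  rewrite mcoeffZ mcoeffX; case: eqP => [<-|uN]; first by rewrite mulr1.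
  rewrite mulr0; apply/eqP; rewrite mcoeff_eq0; apply/negP => /fE ub.
  by apply: uN; rewrite -ub addmC addmK.
have [LF|] := boolP (live F).
  by rewrite /coords LF cF coef_cls //; case/andP: LF.
by rewrite /live fitF negbK => /(cls_eq0 _).2 ->; rewrite !scaler0.
Qed.

Lemma strand_deg alpha : (forall F, alpha F != 0 -> fits F) ->
  ext_deg (Deg b) (strand alpha).
Proof.
move=> fa F; rewrite ffunE scale_cls.
exists (alpha F *: 'X_[b - xF F]) => // u.
have [->|/fa fitF] := eqVneq (alpha F) 0; first by rewrite scale0r msupp0.
move=> /msuppZ_le; rewrite msuppX inE => /eqP ->.
by rewrite -{2}(submK (m := xF F) (m' := b)) -?fits_le // DegD addrK.
Qed.

End Strand.

(** * A basis of the homology indexed by the critical simplices *)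

Section HomologyBasis.
Variables (n : nat) (K : fieldType) (I : idealr {mpoly K[n]}).
Variable A : 'X_{1..n} -> Prop.
Hypothesis genI : generated_by I A.
Variables (b : 'X_{1..n}) (j m : 'I_n).
Implicit Types (F G : {set 'I_n}) (l : 'I_n) (alpha gamma : {set 'I_n} -> K).
Implicit Types (i : nat) (c w : ext I).

(** The live simplices containing [m] that are left unmatched when each live
    simplex avoiding [m] is paired with its union with [m]. *)
Definition critical G : bool :=
  [&& m \in G, live I b G & 'X_[b - xF (G :\ m)] \in I].

(** The simplices of [K_i(x_n, ..., x_j)]. *)
Definition face i F : Prop := #|F| = i /\ forall l, l \in F -> (j <= l)%N.

(** The chain of coefficient 1 on [G]. *)
Definition delta G F : K := (F == G)%:R.

Lemma delta_neq0 G F : delta G F != 0 -> F = G.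
Proof. by rewrite /delta; have [//|] := eqVneq F G; rewrite eqxx. Qed.

(* [m] is the largest variable of [x^b]; nothing is said of [m] if [b = 0]. *)
Hypothesis m_max : forall l, l \in supp b -> (l <= m)%N /\ m \in supp b.
(* The only consequence of the [k]-Borel property needed in this part; it is
   immediate for [l = m]. *)
Hypothesis critical_facet : forall G, critical G ->
  forall l, l \in G -> 'X_[b - xF (G :\ l)] \in I.

Lemma face_setU1 i F l : l \notin F -> face i.+1 (l |: F) -> face i F.
Proof.
move=> lF [+ H]; rewrite cardsU1 lF add1n => -[cF]; split=> // p pF.
by apply: H; rewrite inE pF orbT.
Qed.

Lemma bd_neq0 alpha F :
  bd alpha F != 0 -> exists2 l, l \notin F & alpha (l |: F) != 0.
Proof.
move=> nz; apply/exists_inP; apply: contraNT nz => /exists_inPn H.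
apply/eqP; rewrite /bd big1 // => l lF.
by have := H l lF; rewrite negbK => /eqP ->; rewrite mulr0.
Qed.

Section OffApex.
Variable gamma : {set 'I_n} -> K.
Hypothesis gamma_supp : forall G, gamma G != 0 -> fits b G /\ m \in G.
Hypothesis bd_gamma : forall F, live I b F -> m \notin F -> bd gamma F = 0.

(** The coefficient of [bd gamma] on [G :\ m] is that of [gamma] on [G], up to
    sign, so [G :\ m] cannot be live. *)
Lemma apex_critical G : live I b G -> gamma G != 0 -> critical G.
Proof.
move=> LG gG; have [fitG mG] := gamma_supp gG; rewrite /critical mG LG /=.
apply: contraR gG => NI.
have mGm : m \notin G :\ m by rewrite !inE eqxx.
have LF : live I b (G :\ m).
  by rewrite /live NI andbT; apply: subset_trans fitG; apply: subD1set.
have := bd_gamma LF mGm.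
rewrite /bd (bigD1 m) //= setD1K // big1 ?addr0 => [/eqP|l /andP[lF lm]].
  by rewrite mulf_eq0 signr_eq0.
suff -> : gamma (l |: G :\ m) = 0 by rewrite mulr0.
apply/eqP; apply: contraT => /gamma_supp[_].
by rewrite !inE eqxx eq_sym (negbTE lm).
Qed.

(** If [l |: F] carries a nonzero coefficient then it is critical, and its facet
    [F] cannot be live. *)
Lemma apex_cycle F : live I b F -> bd gamma F = 0.
Proof.
move=> LF; apply/eqP; apply: contraT => /bd_neq0[l lF gl].
have [fitl _] := gamma_supp gl.
have /apex_critical/(_ gl)/critical_facet := live_setU1 lF LF fitl.
move=> /(_ l (setU11 _ _)); rewrite setU1K // => NI.
by case/andP: LF => _; rewrite NI.
Qed.

End OffApex.

Section Sweep.
Variables (i : nat) (alpha : {set 'I_n} -> K).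
Hypothesis i_gt0 : (0 < i)%N.
Hypothesis alpha_supp : forall F, alpha F != 0 -> fits b F /\ face i F.

(** The chain whose boundary is subtracted from [alpha] to sweep it onto the
    simplices containing [m]; the sign is that of [m] in [m |: F] when [m] is larger than
    the [i] elements of [F]. *)
Definition filling : {set 'I_n} -> K := cone m (fun F => (-1) ^+ i * alpha F).

(** A chain homologous to [alpha] and supported on simplices containing [m]. *)
Definition swept F : K := alpha F - bd filling F.

Lemma filling_supp F : filling F != 0 -> fits b F /\ face i.+1 F.
Proof.
rewrite /filling /cone; case: ifP => [mF|]; last by rewrite eqxx.
rewrite mulf_eq0 signr_eq0 /= => /alpha_supp[fitF [cF jF]].
have /card_gt0P[l lF] : (0 < #|F :\ m|)%N by rewrite cF.
have [lm mb] := m_max (subsetP fitF l lF).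
rewrite -(setD1K mF); split; first by rewrite /fits subUset sub1set mb.
split=> [|p]; first by rewrite cardsU1 setD11 cF.
by case/setU1P => [->|/jF//]; apply: leq_trans (jF l lF) lm.
Qed.

Lemma bd_filling_supp F : bd filling F != 0 -> fits b F /\ face i F.
Proof.
case/bd_neq0 => l lF /filling_supp[fitF /(face_setU1 lF)]; split=> //.
by move: fitF; rewrite fits_setU1 => /andP[].
Qed.

Lemma swept_supp F : swept F != 0 -> [/\ fits b F, face i F & m \in F].
Proof.
have [mF|mF] := boolP (m \in F); rewrite /swept => nz.
  have [aF|/alpha_supp[]//] := eqVneq (alpha F) 0.
  by move: nz; rewrite aF sub0r oppr_eq0 => /bd_filling_supp[].
move: nz; rewrite bd_cone //; have [->|aF] := eqVneq (alpha F) 0.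
  by rewrite !mulr0 subr0 eqxx.
have [fitF [cF _]] := alpha_supp aF.
suff -> : [set p in F | (p < m)%N] = F.
    by rewrite cF mulrA -exprD addnn -signr_odd odd_double mul1r subrr eqxx.
apply/setP => p; rewrite inE andb_idr // => pF.
rewrite ltn_neqAle (m_max (subsetP fitF p pF)).1 andbT.
by apply: contraNneq mF => /val_inj <-.
Qed.

Lemma bd_swept F : bd swept F = bd alpha F.
Proof. by rewrite bd_sub bd_bd subr0. Qed.

End Sweep.

Lemma strand_sum (T : Type) (s : seq T) (x : T -> K) (f : T -> {set 'I_n} -> K) :
  \sum_(t <- s) x t *: strand I b (f t) =
  strand I b (fun F => \sum_(t <- s) x t * f t F).
Proof.
apply/ffunP => F; rewrite sum_ffunE ffunE scaler_suml; apply: eq_bigr => t _.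
by rewrite !ffunE scalerA.
Qed.

Lemma strandB alpha gamma :
  strand I b (fun F => alpha F - gamma F) = strand I b alpha - strand I b gamma.
Proof. by apply/ffunP => F; rewrite !ffunE scalerBl. Qed.

Lemma hclass0 i : hclass i j (0 : ext I) = 0.
Proof.
by apply: (addrI (hclass i j 0)); rewrite addr0 /hclass -lpiD addr0.
Qed.

Lemma hclass_sum i (T : Type) (s : seq T) (x : T -> K) (f : T -> ext I) :
  hclass i j (\sum_(t <- s) x t *: f t) = \sum_(t <- s) x t *: hclass i j (f t).
Proof.
elim: s => [|t s IHs]; last first.
  by rewrite !big_cons -IHs /hclass lpiD -lquot_scale_pi.
by rewrite !big_nil hclass0.
Qed.

Lemma strand_delta_cycle i G : critical G -> face i G ->
  is_cycle i j (strand I b (delta G)).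
Proof.
move=> crG faceG; split.
  by apply: strand_koszul => F /delta_neq0 ->.
have fitG F : delta G F != 0 -> fits b F.
  by move=> /delta_neq0 ->; case/and3P: crG => _ /andP[].
rewrite (diff_strand _ fitG); apply/ffunP => F; rewrite !ffunE.
have [->|/bd_neq0[l lF]] := eqVneq (bd (delta G) F) 0; first by rewrite scale0r.
move=> /delta_neq0 GE.
have lG : l \in G by rewrite -GE setU11.
have /(cls_eq0 _ _).2 := critical_facet crG lG.
by rewrite -GE setU1K // => ->; rewrite scaler0.
Qed.

(** The basis is given as a family [w] indexed by the [t] with [P t]; [g] and
    [t_of] are the bijections between these [t] and the critical simplices. *)
Lemma homology_basis i (T : eqType) (P : T -> Prop) (w : T -> ext I)
    (g : T -> {set 'I_n}) (t_of : {set 'I_n} -> T) : (0 < i)%N ->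
    (forall t, P t -> [/\ critical (g t), face i (g t) &
                          w t = strand I b (delta (g t))]) ->
    (forall t t', P t -> P t' -> g t = g t' -> t = t') ->
    (forall G, critical G -> face i G -> P (t_of G) /\ g (t_of G) = G) ->
  (forall t, P t -> is_cycle i j (w t) /\ ext_deg (Deg b) (w t)) /\
  is_basis_of (homology (I := I) (i := i) (j := j) (Deg b)) P
    (fun t => hclass i j (w t)).
Proof.
move=> i_gt0 Pw g_inj g_surj.
have fit_delta G F : critical G -> delta G F != 0 -> fits b F.
  by move=> /and3P[_ /andP[fitG _] _] /delta_neq0 ->.
have cyc t : P t -> is_cycle i j (w t) /\ ext_deg (Deg b) (w t).
  move=> /Pw[crG faceG ->]; split; first exact: strand_delta_cycle.
  by apply: strand_deg => F; apply: fit_delta.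
split=> //; split.
- by move=> t /cyc[]; exists (w t).
- move=> s x s_uniq sP sum0 t ts.
  have gs_inj t' : t' \in s -> (g t == g t') = (t == t').
    by move=> t's; apply/eqP/eqP => [|->//]; apply: g_inj; apply: sP.
  have [crt facet _] := Pw _ (sP _ ts).
  pose alpha F := \sum_(t' <- s) x t' * delta (g t') F.
  have sumE : \sum_(t' <- s) x t' *: w t' = strand I b alpha.
    rewrite -strand_sum; apply: eq_big_seq => t' /sP/Pw[_ _ ->] //.
  have [d dK dE] : exists2 d, d \in koszul i.+1 j & strand I b alpha = diff d.
    have /lpi_eq : hclass i j (\sum_(t' <- s) x t' *: w t') = hclass i j 0.
      by rewrite hclass_sum sum0 hclass0.
    by rewrite subr0 sumE => /asboolP.
  have alphaE F : live I b F -> alpha F = bd (coords b d) F.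
    by move=> LF; rewrite -(coords_diff genI) // -dE (coords_strand genI).
  have d_supp F : coords b d F != 0 -> fits b F /\ face i.+1 F.
    by move=> nz; split; [exact: coords_fits nz | exact: coords_koszul dK nz].
  have alpha_t : alpha (g t) = x t.
    rewrite /alpha (bigD1_seq t) //= /delta eqxx mulr1.
    rewrite big_seq_cond big1 ?addr0 // => t' /andP[t's t't].
    by rewrite gs_inj // eq_sym (negbTE t't) mulr0.
  (* Sweeping [coords b d] does not change its boundary, which vanishes on the
     live simplices avoiding [m], hence on all the live ones. *)
  rewrite -alpha_t alphaE; last by case/and3P: crt.
  rewrite -(bd_swept i.+1); apply: apex_cycle; last by case/and3P: crt.
    by move=> G /(swept_supp _ d_supp) [].
  move=> F LF mF; rewrite bd_swept -alphaE // /alpha big_seq big1 // => t' /sP.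
  case/Pw => /and3P[mG _ _] _ _; rewrite /delta; case: eqP; last by rewrite mulr0.
  by move=> FE; rewrite FE mG in mF.
move=> h [c [[cK dc0] degc ->]].
pose alpha := coords b c; pose gamma := swept i alpha.
have cE : c = strand I b alpha by rewrite (coordsK genI).
have alpha_supp F : alpha F != 0 -> fits b F /\ face i F.
  by move=> nz; split; [exact: coords_fits nz | exact: coords_koszul cK nz].
have gamma_supp := swept_supp i_gt0 alpha_supp.
have gamma_crit G : live I b G -> gamma G != 0 -> critical G.
  apply: apex_critical => [F /gamma_supp[]//|F LF _].
  rewrite bd_swept -(coords_diff genI) // dc0.
  by rewrite /coords LF ffunE -cls0 (coef_cls genI) ?mcoeff0 //; case/andP: LF.
have -> : hclass i j c = hclass i j (strand I b gamma).
  apply/lpi_eq; apply/asboolP; exists (strand I b (filling i alpha)).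
    apply: strand_koszul => F.
    by case/(filling_supp i_gt0 alpha_supp).
  rewrite diff_strand => [|F /(filling_supp i_gt0 alpha_supp)[]//].
  by rewrite cE strandB subKr.
pose D := [seq G <- enum {: {set 'I_n}} | `[< critical G /\ face i G >]].
have D_uniq : uniq D by exact/filter_uniq/enum_uniq.
have DP G : G \in D -> critical G /\ face i G.
  by rewrite mem_filter => /andP[/asboolP].
exists (map t_of D), (fun t => gamma (g t)); split.
  by move=> _ /mapP[G /DP[crG faceG] ->]; case: (g_surj G crG faceG).
rewrite -hclass_sum; congr (hclass _ _ _); rewrite big_map.
have -> : \sum_(G <- D) gamma (g (t_of G)) *: w (t_of G) =
          \sum_(G <- D) gamma G *: strand I b (delta G).
  apply: eq_big_seq => G /DP[crG faceG]; have [Pt gt] := g_surj G crG faceG.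
  by have [_ _ ->] := Pw _ Pt; rewrite gt.
rewrite strand_sum; apply: eq_strand => F.
- by case/gamma_supp.
- apply: contraNT => NF; apply/eqP; rewrite big_seq big1 // => G /DP[crG _].
  have -> : delta G F = 0; last by rewrite mulr0.
  by apply/eqP; apply: contraNT NF; apply: fit_delta.
move=> LF; have [FD|FD] := boolP (F \in D).
  rewrite (bigD1_seq F) //= /delta eqxx mulr1.
  by rewrite big1 ?addr0 // => G GF; rewrite eq_sym (negbTE GF) mulr0.
have -> : gamma F = 0.
  apply/eqP; apply: contraNT FD => gF.
  rewrite mem_filter mem_enum andbT; apply/asboolP; split.
    exact: gamma_crit.
  by case: (gamma_supp _ gF).
rewrite big_seq big1 // => G GD; rewrite /delta; case: eqP => [FE|].
  by rewrite FE GD in FD.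
by rewrite mulr0.
Qed.

End HomologyBasis.

(** * Critical simplices of a Borel ideal and minimal generators *)

Section Extrema.
Variable n : nat.
Implicit Types (F : {set 'I_n.+1}) (l m : 'I_n.+1).

Lemma set_maxP F l : l \in F -> set_max F \in F /\ (l <= set_max F)%N.
Proof.
move=> lF; have -> : set_max F = [arg max_(p > l in F) (p : nat)]%N.
  (* The default value of an arg max only matters for an empty range. *)
  rewrite /set_max /arg_max /extremum; case: pickP => //= noMax.
  case: (@arg_maxnP _ l (mem F) (fun p => p : nat) lF) => q qF qmax.
  have /negP[] := negbT (noMax q); apply/andP; split=> //.
  by apply/forallP => p; apply/implyP => /qmax.
by case: arg_maxnP => // q qF qmax; split=> //; apply: qmax.
Qed.

Lemma set_minP F l : l \in F -> set_min F \in F /\ (set_min F <= l)%N.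
Proof.
move=> lF; have -> : set_min F = [arg min_(p < l in F) (p : nat)]%N.
  rewrite /set_min /arg_min /extremum; case: pickP => //= noMin.
  case: (@arg_minnP _ l (mem F) (fun p => p : nat) lF) => q qF qmin.
  have /negP[] := negbT (noMin q); apply/andP; split=> //.
  by apply/forallP => p; apply/implyP => /qmin.
by case: arg_minnP => // q qF qmin; split=> //; apply: qmin.
Qed.

Lemma set_max_unique F m :
  m \in F -> (forall l, l \in F -> (l <= m)%N) -> set_max F = m.
Proof.
move=> mF Fm; have [MF mM] := set_maxP mF.
by apply/val_inj/eqP; rewrite eqn_leq mM andbT; apply: Fm.
Qed.

End Extrema.

Section KBorel.
Variables (n : nat) (K : fieldType) (I : idealr {mpoly K[n.+1]}).
Variable A : 'X_{1..n.+1} -> Prop.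
Hypothesis genI : generated_by I A.
Variables (k : nat) (b : 'X_{1..n.+1}).
Hypothesis b_bounded : bounded_monom k b.
Hypothesis borel : forall u : 'X_{1..n.+1}, bounded_monom k u -> 'X_[u] \in I ->
  forall j i : 'I_n.+1, j \in supp u -> (i < j)%N ->
  bounded_monom k (U_(i) + (u - U_(j)))%MM -> 'X_[U_(i) + (u - U_(j))] \in I.
Implicit Types (F G : {set 'I_n.+1}) (l : 'I_n.+1) (u : 'X_{1..n.+1}).

Local Notation m := (mvar b).

Lemma mvar_max l : l \in supp b -> (l <= m)%N /\ m \in supp b.
Proof. by move=> /set_maxP[]. Qed.

Lemma bounded_le u : (u <= b)%MM -> bounded_monom k u.
Proof. by move=> /mnm_lepP ub l; apply: leq_trans (ub l) (b_bounded l). Qed.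

(** The Borel move [x_l (u / x_m)], applied to [u = x^b / x^(G - m)], gives
    [x^b / x^(G - l)]. *)
Lemma borel_critical_facet G : critical I b m G ->
  forall l, l \in G -> 'X_[b - xF (G :\ l)] \in I.
Proof.
case/and3P => mG /andP[fitG _] uI l lG.
have [->//|lm] := eqVneq l m.
have lb : b l != 0%N by rewrite -mem_supp (subsetP fitG).
have mb : b m != 0%N by rewrite -mem_supp (subsetP fitG).
have E : (U_(l) + (b - xF (G :\ m) - U_(m)) = b - xF (G :\ l))%MM.
  apply/mnmP => i; rewrite mnmDE !mnmBE !mnm1E !mnmE !inE.
  have [<-|li] := eqVneq l i.
    by rewrite lm lG /= eq_sym (negbTE lm) subn0 subn0 add1n subn1 prednK ?lt0n.
  rewrite add0n [i == m]eq_sym; have [<-|mi] /= := eqVneq m i; last first.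
    by rewrite subn0.
  by rewrite mG subn0.
rewrite -E; apply: borel uI _ _ _ _ _; rewrite ?E.
- exact/bounded_le/lem_subr.
- by rewrite mem_supp sub_xF_notin // !inE eqxx.
- have [] := mvar_max (subsetP fitG l lG); rewrite leq_eqVlt => /orP[/eqP/val_inj E'|//].
  by rewrite E' eqxx in lm.
- exact/bounded_le/lem_subr.
Qed.

Lemma critical_generator G : critical I b m G ->
  [/\ mem_G I (b - xF (G :\ m))%MM, mvar (b - xF (G :\ m))%MM = m,
      forall l, l \in G :\ m -> (l < m)%N &
      (xF (G :\ m) + (b - xF (G :\ m)) = b)%MM].
Proof.
move=> /and3P[mG /andP[fitG GI] uI]; set F := G :\ m.
have mF : m \notin F by rewrite !inE eqxx.
have mb : m \in supp b by exact: (subsetP fitG).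
have lt_m l : l \in supp b -> l != m -> (l < m)%N.
  by move=> lb lm; rewrite ltn_neqAle (mvar_max lb).1 andbT.
have mu : (b - xF F)%MM m != 0%N by rewrite sub_xF_notin // -mem_supp.
have sub_supp l : (b - xF F)%MM l != 0%N -> l \in supp b.
  by rewrite mnmBE mem_supp; apply: contraNneq => ->.
have GE : (b - xF G = b - xF F - U_(m))%MM by rewrite -{1}(setD1K mG) sub_xF_setU1.
split.
- apply/(mem_GP _ genI); split=> // l ul.
  have [->|lm] := eqVneq l m; first by rewrite -GE.
  (* If [u / x_l] were in [I] for some [l < m], where [u = x^b / x^(G - m)], the
     Borel move from [m] to [l] would put [u / x_m = x^b / x^G] in [I]. *)
  apply: contra GI => vI; rewrite GE.
  have E : (U_(l) + (b - xF F - U_(l) - U_(m)) = b - xF F - U_(m))%MM.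
    apply/mnmP => i; rewrite mnmDE ![in LHS]mnmBE ![in RHS]mnmBE !mnm1E -!mnmBE.
    have [<-|_] := eqVneq l i; last by rewrite add0n subn0.
    by rewrite eq_sym (negbTE lm) !subn0 add1n subn1 prednK ?lt0n.
  rewrite -E; apply: borel vI _ _ _ _ _; rewrite ?E.
  + exact/bounded_le/(lepm_trans (lem_subr _ _))/lem_subr.
  + by rewrite mem_supp mnmBE mnm1E (negbTE lm) subn0.
  + by apply: lt_m => //; apply: sub_supp.
  + exact/bounded_le/(lepm_trans (lem_subr _ _))/lem_subr.
- apply: set_max_unique => [|l]; first by rewrite mem_supp.
  by rewrite mem_supp => /sub_supp/mvar_max[].
- by move=> l; rewrite !inE => /andP[lm lG]; apply: lt_m => //; apply: (subsetP fitG).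
rewrite addmC submK // -fits_le; apply: subset_trans fitG; exact: subD1set.
Qed.

Lemma generator_critical u F : mem_G I u -> (forall l, l \in F -> (l < mvar u)%N) ->
    (xF F + u = b)%MM ->
  [/\ mvar u = m, critical I b m (m |: F) &
      chain I 'X_[mprime u] (m |: F) = strand I b (delta K (m |: F))].
Proof.
move=> /(mem_GP _ genI)[uI uN] Fm ub.
(* [m(u)] is meaningful because [I] is proper, so that [u] is not 1. *)
have u_neq0 : u != 0%MM.
  by apply: contraTneq uI => ->; rewrite mpolyX0 idealr1.
have [l ul] : exists l, l \in supp u.
  apply/existsP; apply: contraNT u_neq0 => /existsPn ul; apply/eqP/mnmP => l.
  by have := ul l; rewrite mem_supp negbK mnm0E => /eqP.
have [Mu _] := set_maxP ul.
have bE i : b i = ((i \in F) + u i)%N by rewrite -ub mnmDE mnmE.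
have MF : mvar u \notin F by apply/negP => /Fm; rewrite ltnn.
have ME : mvar b = mvar u.
  apply: set_max_unique => [|i].
    by rewrite mem_supp bE (negbTE MF) -mem_supp.
  rewrite mem_supp bE; case: (boolP (i \in F)) => [/Fm/ltnW //|_].
  by rewrite add0n -mem_supp => /set_maxP[].
have uE : (b - xF F)%MM = u by rewrite -ub addmC addmK.
have GE : (b - xF (mvar u |: F))%MM = mprime u by rewrite sub_xF_setU1 // uE.
rewrite ME; split=> //.
  rewrite /critical setU11 setU1K // uE uI andbT /live GE uN -?mem_supp // andbT.
  rewrite fits_setU1 fits_le bE (negbTE MF) -mem_supp Mu /=.
  by rewrite -ub lem_addr.
apply/ffunP => G; rewrite !ffunE /delta.
by case: eqP => [->|]; rewrite ?scale0r ?scale1r ?GE.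
Qed.

(** No sign appears: every element of [F] is smaller than [l]. *)
Lemma wedge_chain1 (f : {mpoly K[n.+1]}) F l : (forall p, p \in F -> (p < l)%N) ->
  wedge (chain I f F) (chain I 1 [set l]) = chain I f (l |: F).
Proof.
move=> Fl; have lF : l \notin F by apply/negP => /Fl; rewrite ltnn.
have term0 G : term (0 : SmodI I) G = 0.
  by apply/ffunP => G'; rewrite !ffunE if_same.
rewrite /wedge (bigD1 F) //= [X in _ + X]big1 ?addr0 => [|G GF]; last first.
  apply: big1 => G' _; have -> : chain I f F G = 0 by rewrite ffunE (negbTE GF).
  by rewrite mul0r mulr0; exact: term0.
rewrite (bigD1 [set l]) /=; last by rewrite disjoint_sym disjoints1.
rewrite big1 ?addr0 => [|G /andP[_ GF]]; last first.
  have -> : chain I 1 [set l] G = 0 by rewrite ffunE (negbTE GF).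
  by rewrite !mulr0; exact: term0.
rewrite !ffunE !eqxx cls1 mulr1 setUC.
suff -> : [set pq in setX F [set l] | (pq.2 < pq.1)%N] = set0.
  by rewrite cards0 mul1r.
apply/setP => -[p q]; rewrite !inE /=; apply/negP => /andP[/andP[/Fl pl /eqP ->]].
by rewrite ltnNge ltnW.
Qed.

End KBorel.

(** * The basis indexed by minimal generators *)

Lemma bounded_vec_Deg n (k : nat) (a : 'rV[int]_n) : bounded_vec k a ->
  exists2 b : 'X_{1..n}, bounded_monom k b & a = Deg b.
Proof.
move=> ha; exists [multinom absz (a 0%R l) | l < n] => [l|].
  by case/andP: (ha l) => a0 ak; rewrite mnmE -lez_nat gez0_abs.
by apply/rowP => l; rewrite mxE mnmE; case/andP: (ha l) => a0 _; rewrite gez0_abs.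
Qed.

Theorem theorem2p1 (K : fieldType) (n k : nat) (hk : (1 <= k)%N)
  (I : idealr {mpoly K[n.+1]}) (hI : k_borel k I)
  (a : 'rV[int]_n.+1) (ha : bounded_vec k a) (j : 'I_n.+1) :
  (forall i : nat, (1 < i)%N ->
    let index (p : 'X_{1..n.+1} * {set 'I_n.+1}) :=
      [/\ mem_G I p.1, #|p.2| = i.-1, (j <= set_min p.2)%N,
          (set_max p.2 < mvar p.1)%N & Deg (xF p.2 + p.1)%MM = a] in
    let cycle (p : 'X_{1..n.+1} * {set 'I_n.+1}) :=
      wedge (chain I 'X_[mprime p.1] p.2) (chain I 1 [set mvar p.1]) in
    (forall p, index p -> is_cycle i j (cycle p) /\ ext_deg a (cycle p)) /\
    is_basis_of (homology (I := I) (i := i) (j := j) a) index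
      (fun p => hclass i j (cycle p))) /\
  (let index (u : 'X_{1..n.+1}) :=
     [/\ mem_G I u, (j <= mvar u)%N & Deg u = a] in
   let cycle (u : 'X_{1..n.+1}) :=
     chain I 'X_[mprime u] [set mvar u] in
   (forall u, index u -> is_cycle 1 j (cycle u) /\ ext_deg a (cycle u)) /\
   is_basis_of (homology (I := I) (i := 1) (j := j) a) index
     (fun u => hclass 1 j (cycle u))).
Proof.
case: hI => -[A _ genI] borel.
have [b b_bounded {ha}->] := bounded_vec_Deg ha.
pose m := mvar b.
have facet := borel_critical_facet b_bounded borel.
have to_crit := generator_critical genI (b := b).
have of_crit := critical_generator genI b_bounded borel.
split=> [i i_gt1 index cycle|index cycle]; rewrite {}/cycle.
  have lt_max p : index p -> forall l, l \in p.2 -> (j <= l)%N /\ (l < mvar p.1)%N.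
    case=> _ _ jp pm _ l lp; split; last exact: leq_ltn_trans (set_maxP lp).2 pm.
    exact: leq_trans jp (set_minP lp).2.
  have indexP p : index p -> [/\ mvar p.1 = m, critical I b m (m |: p.2),
      chain I 'X_[mprime p.1] (m |: p.2) = strand I b (delta K (m |: p.2)),
      (xF p.2 + p.1)%MM = b & m \notin p.2].
    move=> ip; case: (ip) => Gp _ _ _ /Deg_inj pb.
    have pm l (lp : l \in p.2) := (lt_max p ip l lp).2.
    have [pE crit_p chain_p] := to_crit _ _ Gp pm pb.
    by split=> //; apply/negP => /pm; rewrite pE ltnn.
  apply: (homology_basis genI (@mvar_max _ b) facet (g := fun p => m |: p.2)
    (t_of := fun G => ((b - xF (G :\ m))%MM, G :\ m))); first exact: ltnW.
  - move=> p ip; have [pE crit_p chain_p pb mp] := indexP p ip.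
    split=> //; last first.
      by rewrite wedge_chain1 ?pE // => l /(lt_max p ip)[]; rewrite pE.
    case: (ip) => _ cp _ _ _; split; first by rewrite cardsU1 mp cp add1n prednK // ltnW.
    move=> l; rewrite !inE => /predU1P[->|/(lt_max p ip)[]//].
    have /card_gt0P[q /(lt_max p ip)[jq qm]] : (0 < #|p.2|)%N.
      by rewrite cp -subn1 subn_gt0.
    by rewrite -pE; apply: leq_trans jq (ltnW qm).
  - move=> p q ip iq E; have [_ _ _ pb mp] := indexP p ip.
    have [_ _ _ qb mq] := indexP q iq.
    have E2 : p.2 = q.2 by rewrite -(setU1K mp) E setU1K.
    have E1 : p.1 = q.1.
      by rewrite -[p.1](addmK (xF p.2)) addmC pb -qb E2 addmC addmK.
    by case: p q E1 E2 {ip iq E pb mp qb mq} => [? ?] [? ?] /= -> ->.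
  move=> G critG [cG jG]; have [GG GE Gm GB] := of_crit G critG.
  have mG : m \in G by case/and3P: critG.
  split; last exact: setD1K.
  have cD : #|G :\ m| = i.-1 by rewrite -cG (cardsD1 m G) mG.
  have /card_gt0P[q qD] : (0 < #|G :\ m|)%N by rewrite cD -subn1 subn_gt0.
  split=> //=.
  - by have [] := set_minP qD; rewrite in_setD1 => /andP[_ /jG].
  - by rewrite GE; apply: Gm; case: (set_maxP qD).
  by rewrite GB.
have indexP u : index u -> [/\ u = b, critical I b m [set m] &
    chain I 'X_[mprime u] [set m] = strand I b (delta K [set m])].
  case=> Gu _ /Deg_inj ub.
  have no_lt (l : 'I_n.+1) : l \in set0 -> (l < mvar u)%N by rewrite inE.
  have u0 : (xF set0 + u)%MM = b.
    by rewrite -ub; apply/mnmP => l; rewrite mnmDE mnmE inE.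
  have [uE crit_u chain_u] := to_crit u set0 Gu no_lt u0.
  by rewrite -(setU0 [set m]).
apply: (homology_basis genI (@mvar_max _ b) facet (g := fun u => [set m])
  (t_of := fun G => b)) => //.
- move=> u iu; have [ub crit_u chain_u] := indexP u iu.
  split=> //; last by rewrite -chain_u ub.
  split; first exact: cards1.
  by move=> l /set1P ->; case: iu => _ + _; rewrite ub.
- by move=> u v /indexP[-> _ _] /indexP[-> _ _].
move=> G critG [cG jG]; have [GG GE Gm GB] := of_crit G critG.
have mG : m \in G by case/and3P: critG.
have GM : G = [set m].
  by apply/esym/eqP; rewrite eqEcard sub1set mG cG cards1.
have D0 : xF (G :\ m) = 0%MM.
  by apply/mnmP => l; rewrite mnmE mnm0E GM setDv inE.
move: GG; rewrite D0 => Gb.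
have bE : (b - 0 = b)%MM by apply/mnmP => l; rewrite mnmBE mnm0E subn0.
by rewrite bE in Gb; split=> //; split=> //; apply: jG.
Qed.
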